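(* Let $(\Omega,\mu,d)$ be a metric measure space with $\Omega$ compact and connected. Let $J\ge0$ be a kernel on $\Omega\times\Omega$ satisfying $J(x,y)=J(y,x)$ and $$J(x,y)>0\quad\text{for all }x,y\in\Omega\text{ such that }d(x,y)<R,\quad\text{for some }R>0,$$ and let $K_Ju(x)=\int_\Omega J(x,y)u(y)\,dy$. Assume that $K_J\in\mathcal L(L^p(\Omega),\mathcal C_b(\Omega))$ is compact for some $1\le p\le\infty$. Then $K_J\in\mathcal L(\mathcal C_b(\Omega),\mathcal C_b(\Omega))$ is compact, the spectral radius $r_{\mathcal C_b(\Omega)}(K_J)$ is a positive simple eigenvalue of $K_J$, and its associated eigenfunction can be taken strictly positive.
   Context: A metric measure space $(\Omega,\mu,d)$ is a metric space $(\Omega,d)$ with a $\sigma$-finite, regular, complete Borel measure $\mu$ that associates a finite positive measure to the balls of $\Omega$. Integration $dy$ is with respect to $\mu$. $\mathcal C_b(\Omega)$ is the space of bounded continuous functions with the sup norm; $\mathcal L(X,Y)$ is the space of bounded linear operators. $r_{\mathcal C_b(\Omega)}(K_J)=\sup|\sigma(K_J)|$ is the spectral radius of $K_J$ as an operator in $\mathcal C_b(\Omega)$. *)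

(* Defs.v *)
From HB Require Import structures.
From mathcomp Require Import all_boot all_order all_algebra.
From mathcomp.real_closed Require Import complex.
From mathcomp Require Import all_classical all_reals all_analysis.

Set Implicit Arguments.
Unset Strict Implicit.
Unset Printing Implicit Defensive.

Import Order.TTheory GRing.Theory Num.Theory.
Import numFieldNormedType.Exports.

Local Open Scope classical_set_scope.
Local Open Scope ring_scope.

(* A metric space and a sigma-algebra on the same carrier. The two structures
   are independent here: [metric_measure] relates them. A [measurableType] is
   pointed, so the space is nonempty. *)
#[short(type="metricMeasurableType")]
HB.structure Definition MetricMeasurable (R : numDomainType)
    (d : measure_display) := {T of Metric R T & Measurable d T}.

(* The sigma-algebra need not be the Borel one, which is in general too small
   for a complete measure; it only has to contain it. *)
Record metric_measure (R : realType) (d : measure_display)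
    (T : metricMeasurableType R d) (mu : {measure set T -> \bar R}) : Prop :=
  MetricMeasure {
    mm_borel : forall U : set T, open U -> measurable U;
    mm_sigma_finite : sigma_finite [set: T] mu;
    mm_outer_regular : forall A : set T, measurable A ->
      mu A = ereal_inf [set mu U | U in [set U : set T | open U /\ A `<=` U]];
    mm_inner_regular : forall A : set T, measurable A ->
      mu A =
      ereal_sup [set mu C | C in [set C : set T | compact C /\ C `<=` A]];
    mm_complete : measure_is_complete mu;
    mm_ball : forall (x : T) (e : R), 0 < e ->
      (0 < mu (ball x e))%E /\ (mu (ball x e) < +oo)%E
  }.

Section bounded_continuous.
Context (R : realType) (T : topologicalType).

Definition bcont : {pred T -> R} :=
  mem [set f : T -> R | continuous f /\ bounded_fun f].

Lemma bcontP (f : T -> R) :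
  f \in bcont <->
  continuous f /\ exists M : R, forall x, `|f x| <= M.
Proof.
rewrite inE/=; split => -[cf].
  move=> bf; split => //.
  have [M fM] := filter_ex (bf : \forall M \near +oo, globally setT [set x | `|f x| <= M]).
  by exists M => x; exact: fM.
move=> [M fM]; split=> //; exists M; split; first exact: num_real.
by move=> N MN x _; exact: le_trans (fM x) (ltW MN).
Qed.

Lemma bcont_submod_closed : submod_closed bcont.
Proof.
split.
  apply/bcontP; split; first exact: cst_continuous.
  by exists 0 => x; rewrite normr0.
move=> a f g /bcontP[cf [M fM]] /bcontP[cg [N gN]]; apply/bcontP; split.
  by move=> x; apply: cvgD; [apply: cvgZr; exact: cf|exact: cg].
exists (`|a| * M + N) => x; rewrite (le_trans (ler_normD _ _))// lerD//.
by rewrite normrM ler_wpM2l.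
Qed.

HB.instance Definition _ :=
  GRing.isSubmodClosed.Build R (T -> R) bcont bcont_submod_closed.

Record Cb := MkCb { Cb_fun :> T -> R; Cb_mem : Cb_fun \in bcont }.

HB.instance Definition _ := [isSub for Cb_fun].
HB.instance Definition _ := [Choice of Cb by <:].
HB.instance Definition _ := [SubChoice_isSubLmodule of Cb by <:].

Definition sup_norm (f : Cb) : R := sup (range (fun x => `|f x|)).

Lemma sup_norm_ge (f : Cb) x : `|f x| <= sup_norm f.
Proof.
have [_ [M fM]] := (bcontP f).1 (Cb_mem f).
by apply: ub_le_sup; [exists M => _ [y _ <-]; exact: fM|exists x].
Qed.

Lemma sup_norm_ge0 (f : Cb) : 0 <= sup_norm f.
Proof.
have [[x _]|/forallNP T0] := pselect (exists x : T, True).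
  exact: le_trans (normr_ge0 _) (sup_norm_ge f x).
rewrite /sup_norm (_ : [set: T] = set0) ?image_set0 ?sup0//.
by apply/seteqP; split => // x _; exact: (T0 x).
Qed.

Lemma sup_norm_le (f : Cb) (M : R) :
  0 <= M -> (forall x, `|f x| <= M) -> sup_norm f <= M.
Proof.
move=> M0 fM; have [[x _]|/forallNP T0] := pselect (exists x : T, True).
  by apply: ge_sup => [|_ [y _ <-]]; [exists `|f x|, x|exact: fM].
rewrite /sup_norm (_ : [set: T] = set0) ?image_set0 ?sup0//.
by apply/seteqP; split => // x _; exact: (T0 x).
Qed.

Lemma sup_normD (f g : Cb) : sup_norm (f + g) <= sup_norm f + sup_norm g.
Proof.
apply: sup_norm_le => [|x]; first by rewrite addr_ge0 ?sup_norm_ge0.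
by rewrite (le_trans (ler_normD _ _))// lerD ?sup_norm_ge.
Qed.

Lemma sup_normZ (a : R) (f : Cb) : sup_norm (a *: f) = `|a| * sup_norm f.
Proof.
have le_normZ b (g : Cb) : sup_norm (b *: g) <= `|b| * sup_norm g.
  apply: sup_norm_le => [|x]; first by rewrite mulr_ge0 ?sup_norm_ge0.
  by rewrite normrM ler_wpM2l ?sup_norm_ge.
apply/eqP; rewrite eq_le le_normZ/=.
have [->|a0] := eqVneq a 0; first by rewrite normr0 mul0r sup_norm_ge0.
rewrite mulrC -ler_pdivlMr ?normr_gt0// mulrC -normfV.
by rewrite (le_trans _ (le_normZ _ _))// scalerA mulVf// scale1r.
Qed.

Lemma sup_norm0_eq0 (f : Cb) : sup_norm f = 0 -> f = 0.
Proof.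
move=> f0; apply/val_inj/funext => x; apply/eqP.
by rewrite -normr_le0 -f0 sup_norm_ge.
Qed.

HB.instance Definition _ := Lmodule_isNormed.Build R Cb
  sup_normD sup_normZ sup_norm0_eq0.

End bounded_continuous.
Arguments Cb : clear implicits.

(* The source carries a seminorm [nU] given explicitly so as to cover both a
   normed space and the p-integrable functions with the L^p seminorm. *)
Section operators.
Context (R : realType) (U : lmodType R) (V : normedModType R) (nU : U -> R).

Definition bounded_operator (A : {linear U -> V}) : Prop :=
  exists C : R, forall u, `|A u| <= C * nU u.

Definition compact_operator (A : {linear U -> V}) : Prop :=
  precompact (A @` [set u | nU u <= 1]).

End operators.

Section spectrum.
Context (R : realType) (X : normedModType R).
Implicit Type A : {linear X -> X}.

(* The pair (u, v) stands for u + i v: this is z - A on the complexification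
   of X. The product norm is equivalent to the usual complexification norms,
   so it gives the same bounded operators. *)
Definition complex_shift A (z : R[i]) (w : X * X) : X * X :=
  (complex.Re z *: w.1 - complex.Im z *: w.2 - A w.1,
   complex.Im z *: w.1 + complex.Re z *: w.2 - A w.2).

Definition resolvent_set A : set R[i] :=
  [set z | exists B : X * X -> X * X,
     [/\ continuous B, cancel (complex_shift A z) B
       & cancel B (complex_shift A z)]].

Definition spectrum A : set R[i] := ~` resolvent_set A.

Definition spectral_radius A : R :=
  sup [set ComplexField.Normc.normc z | z in spectrum A].

(* Algebraic simplicity: the generalized eigenspace is one-dimensional. The
   case n = 0 says that [a] is an eigenvalue with a one-dimensional
   eigenspace. *)
Definition simple_eigenvalue A (a : R) : Prop :=
  exists2 phi : X, phi != 0 &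
    forall (n : nat) (u : X),
      iter n.+1 (fun v => A v - a *: v) u = 0 <-> exists c : R, u = c *: phi.

End spectrum.

Section kernel_operator.
Context (R : realType) (d : measure_display) (T : metricMeasurableType R d).
Variable mu : {measure set T -> \bar R}.

Definition kernel_op (J : T -> T -> R) (u : T -> R) (x : T) : R :=
  \int[mu]_y (J x y * u y).

Definition kernel_op_defined (J : T -> T -> R) (u : T -> R) : Prop :=
  forall x, mu.-integrable [set: T] (fun y => (J x y * u y)%:E).

Definition Lp_norm (p : \bar R) (p1 : (1 <= p)%E) (u : LfunType mu p1) : R :=
  fine ('N[mu]_p[EFin \o u])%E.

(* Elements of L^p are represented by p-integrable functions: two functions
   that are equal almost everywhere have the same image, so that such an [A]
   is an operator on L^p, and the two unit balls have the same image. *)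
Definition is_kernel_op_Lp (J : T -> T -> R) (p : \bar R) (p1 : (1 <= p)%E)
    (A : {linear LfunType mu p1 -> Cb R T}) : Prop :=
  forall u : LfunType mu p1,
    kernel_op_defined J u /\ (A u : T -> R) = kernel_op J u.

Definition is_kernel_op_Cb (J : T -> T -> R)
    (A : {linear Cb R T -> Cb R T}) : Prop :=
  forall u : Cb R T, kernel_op_defined J u /\ (A u : T -> R) = kernel_op J u.

End kernel_operator.

(* Main.v *)
Require Import Defs.
From HB Require Import structures.
From mathcomp Require Import all_boot all_order all_algebra.
From mathcomp Require Import all_classical all_reals all_analysis.
From mathcomp Require Import ess_sup_inf measurable_realfun.
From mathcomp.real_closed Require Import complex.
From mathcomp Require Import ring lra.
Import Order.TTheory GRing.Theory Num.Theory.
Import numFieldNormedType.Exports.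
Local Open Scope classical_set_scope.
Local Open Scope ring_scope.
Set Implicit Arguments.
Unset Strict Implicit.
Unset Printing Implicit Defensive.

(** Write K for the kernel operator on continuous functions. It factors as
continuous functions -> L^p -> continuous functions, the first arrow being
bounded because a compact metric measure space has finite measure; so K is
bounded and compact. It is positive, and it spreads positivity: if u >= 0 and
u x > 0 then K u > 0 on the ball of radius R around x, because J y > 0 near x
and nonempty open sets have positive measure. The rest is a Krein-Rutman
argument that uses only these properties of K, together with the compactness
and connectedness of the space. Algebraic
simplicity, too, comes from positivity.

Existence. Let r be the supremum of the l for which some nonzero u >= 0 has
l u <= K u. It is positive, as the constant 1 shows, and by compactness it is
attained by some v ([krein_rutman_eigenvector]). If K v - r v were nonzero,
some iterate of K would make it positive everywhere ([iter_gt0]: the supports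
of the iterates grow by R at each step, and the space is compact and
connected), and the iterate of v would beat r. So K v = r v, and v has no zero
because its zero set would absorb the whole space ([eigen_zero]).

Simplicity. Let K u = r u + c phi with phi > 0 the eigenvector. Slide t down
until t phi just touches u from above; at a contact point x0, positivity of K
at t phi - u reads 0 <= - c phi x0, so c <= 0, and c = 0 by symmetry. There is
thus no Jordan block, and t phi - u is a nonnegative eigenvector with a zero,
that is 0.

Spectral radius. In the norm for which the unit ball is [- phi, phi], K has
norm r, so that z - K is inverted by a Neumann iteration when |z| > r
([resolvent_outside_disk]). The complexified norm is handled by testing
against all real linear forms (a, b) |-> c a + s b with c^2 + s^2 = 1, which
a positive operator visibly respects. The iteration converges because it is
geometrically Cauchy and K is compact. *)

(** * Continuous functions on a compact space *)

Section bounded_continuous_functions.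
Context (R : realType) (T : topologicalType).
Implicit Types u v : Cb R T.

Lemma Cb_addE u v x : (u + v) x = u x + v x. Proof. by []. Qed.
Lemma Cb_oppE u x : (- u) x = - u x. Proof. by []. Qed.
Lemma Cb_scaleE a u x : (a *: u) x = a * u x. Proof. by []. Qed.
Lemma Cb_zeroE x : (0 : Cb R T) x = 0. Proof. by []. Qed.
Definition CbE := (Cb_addE, Cb_oppE, Cb_scaleE, Cb_zeroE).

Lemma Cb_ext u v : (forall x, u x = v x) -> u = v.
Proof. by move=> uv; apply/val_inj/funext. Qed.

Lemma Cb_normr_le u x : `|u x| <= `|u|.
Proof. exact: sup_norm_ge. Qed.

Lemma Cb_le_norm u x : u x <= `|u|.
Proof. exact: le_trans (ler_norm _) (Cb_normr_le _ _). Qed.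

Lemma Cb_norm_le u (M : R) :
  0 <= M -> (forall x, `|u x| <= M) -> `|u| <= M.
Proof. exact: sup_norm_le. Qed.

Lemma Cb_continuous u : continuous u.
Proof. by have [] := (bcontP u).1 (Cb_mem u). Qed.

Lemma cst_bcont (c : R) : (fun _ : T => c) \in @bcont R T.
Proof. by apply/bcontP; split; [exact: cst_continuous|exists `|c|]. Qed.

Definition Cb_cst (c : R) : Cb R T := MkCb (cst_bcont c).

Lemma open_Cb_gt0 u : open [set x | 0 < u x].
Proof.
rewrite (_ : [set _ | _] = u @^-1` [set y | 0 < y])//.
apply: open_comp; last exact: open_gt.
by move=> x _; exact: Cb_continuous.
Qed.

Lemma Cb_gt0_bounded_away u : compact [set: T] ->
  (forall x, 0 < u x) -> exists2 e : R, 0 < e & forall x, e <= u x.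
Proof.
move=> cT u0; have [[t _]|T0] := pselect (exists x : T, True); last first.
  by exists 1 => // x; exfalso; apply: T0; exists x.
have [||c _ cmin] := @compact_EVT_min T R u setT _ cT.
- by exists t.
- exact/continuous_subspaceT/Cb_continuous.
- by exists (u c) => // x; apply: cmin; rewrite inE.
Qed.

End bounded_continuous_functions.

(** * Propagation along chains of balls *)

Section chains.
Context (R : realType) (T : metricType R).

(** P is open, and so is its complement: the hypothesis read backwards says
that a point within rho of a point outside P is outside P. *)
Lemma connected_chain (rho : R) (P : set T) :
  connected [set: T] -> 0 < rho ->
  (forall x y, P x -> mdist x y < rho -> P y) ->
  forall x y, P x -> P y.
Proof.
move=> cT rho0 Pclosed x y Px.
have oP : open P.
  rewrite openE => z Pz; apply: (@filterS _ (nbhs z) _ (ball z rho));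
    last exact: nbhsx_ballx.
  move=> t.
  by rewrite ballEmdist; exact: Pclosed.
have cP : closed P.
  rewrite -[P]setCK; apply: open_closedC.
  rewrite openE => z Pz; apply: (@filterS _ (nbhs z) _ (ball z rho));
    last exact: nbhsx_ballx.
  move=> t.
  rewrite ballEmdist /= metric_sym => tz Pt; apply: Pz.
  exact: Pclosed Pt tz.
suff -> : P = setT by [].
apply: cT; first by exists x.
- by exists P => //; rewrite setTI.
- by exists P => //; rewrite setTI.
Qed.

End chains.

(** * Positive operators that spread positivity *)

Section positive_operator.
Context (R : realType) (T : metricType R).
Context (T_compact : compact [set: T]) (T_connected : connected [set: T]).
Context (t0 : T).
Context (K : {linear Cb R T -> Cb R T}).
Implicit Types u v : Cb R T.

Definition nonneg u := forall x, 0 <= u x.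

Context (K_ge0 : forall u, nonneg u -> nonneg (K u)).
Context (rho : R) (rho_gt0 : 0 < rho).
Context (K_spread : forall u x y,
  nonneg u -> 0 < u x -> mdist x y < rho -> 0 < K u y).

Lemma nonneg_neq0 u : nonneg u -> u != 0 -> exists x, 0 < u x.
Proof.
move=> u0; apply: contra_neqP => /forallNP uN; apply: Cb_ext => x.
by apply/eqP; rewrite eq_le u0 andbT leNgt; apply/negP/uN.
Qed.

Lemma K_mono u v : (forall x, u x <= v x) -> forall x, K u x <= K v x.
Proof.
move=> uv x; rewrite -subr_ge0.
rewrite [leRHS](_ : _ = K (v - u) x); last by rewrite linearB.
by apply: K_ge0 => y; rewrite !CbE subr_ge0.
Qed.

Lemma iter_ge0 n u : nonneg u -> nonneg (iter n K u).
Proof. by elim: n => [//|n IH] u0; apply/K_ge0/IH. Qed.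

(** Since mdist x x = 0, spreading positivity preserves it at the point. *)
Lemma iter_gt0_le m n u x : nonneg u -> (m <= n)%N ->
  0 < iter m K u x -> 0 < iter n K u x.
Proof.
move=> u0 /subnK <-; elim: (n - m)%N => [//|k IH] mx.
rewrite addSn iterS; apply: (K_spread (x := x)) (IH mx) _.
  exact: iter_ge0.
by rewrite mdistxx.
Qed.

(** The positivity sets of the iterates form an increasing sequence of open
sets. By connectedness their union is the whole space, and by compactness one
of them is. *)
Lemma iter_gt0 u : nonneg u -> u != 0 ->
  exists n, forall x, 0 < iter n K u x.
Proof.
move=> u0 /(nonneg_neq0 u0)[x ux].
have reach y : exists n, 0 < iter n K u y.
  apply: (@connected_chain _ _ rho
    [set y | exists n, 0 < iter n K u y] _ _ _ x y) => //.
    move=> z z' [n nz] zz'; exists n.+1.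
    by rewrite iterS; apply: (K_spread _ nz zz'); exact: iter_ge0.
  by exists 0%N.
have /(_ _ \oo (fun n y => 0 < iter n K u y)) :=
  (compact_near_coveringP _).1 T_compact.
case=> [y _|n _ allpos]; last by exists n => y; exact: (allpos n (leqnn n)).
have [n ny] := reach y.
exists ([set z | 0 < iter n K u z], [set m | (n <= m)%N]).
  split; last by exists n.
  by apply: open_nbhs_nbhs; split => //; exact: open_Cb_gt0.
by move=> [z m] /= [nz nm]; exact: (iter_gt0_le u0 nm nz).
Qed.

(** Where w vanishes so does K w, hence w vanishes on the surrounding ball of
radius rho: otherwise positivity would spread back to the zero. *)
Lemma eigen_zero (r : R) (w : Cb R T) x : nonneg w ->
  (forall y, w y = 0 -> K w y <= r * w y) -> w x = 0 -> w = 0.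
Proof.
move=> w0 Kw wx; apply: Cb_ext => y.
apply: (@connected_chain _ _ rho [set y | w y = 0] _ _ _ x y) => //.
move=> z z' /= wz zz'; apply/eqP; rewrite eq_le w0 andbT leNgt.
apply/negP => wz'; have := Kw z wz.
by rewrite wz mulr0 leNgt (K_spread w0 wz')// metric_sym.
Qed.

(** * Existence of a positive eigenvector *)

Context (K_compact : compact_operator Num.norm K).

Lemma compact_cluster (u_ : nat -> Cb R T) : (forall n, `|u_ n| <= 1) ->
  exists v, forall e : R, 0 < e ->
    forall N, exists2 n, (N <= n)%N & `|K (u_ n) - v| < e.
Proof.
move=> u1; have [U KU [cU _]] := K_compact.
have KuU n : U (K (u_ n)) by apply: (KU (K (u_ n))); exists (u_ n); [exact: u1|].
have FU : ((K \o u_) @ \oo) U by exists 0%N => // n _; exact: KuU.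
have [v [_ clv]] := cU _ _ FU.
exists v => e e0 N.
have FN : ((K \o u_) @ \oo) [set K (u_ n) | n in [set n | (N <= n)%N]].
  by exists N => // n Nn; exists n.
have [_ [[n Nn <-] vn]] := clv _ _ FN (nbhsx_ballx v e e0).
by exists n => //; move: vn; rewrite -ball_normE /= distrC.
Qed.

Context (M : R) (K_bounded : forall u, `|K u| <= M * `|u|).

(** This bounds the set whose supremum is the eigenvalue. *)
Lemma collatz_wielandt_le (l : R) u : u != 0 -> nonneg u ->
  (forall x, l * u x <= K u x) -> l <= M.
Proof.
move=> uN0 u0 lu; have un : 0 < `|u| by rewrite normr_gt0.
have M0 : 0 <= M.
  by rewrite -(pmulr_lge0 _ un) (le_trans _ (K_bounded u)).
have [l0|l0] := leP l 0; first exact: le_trans M0.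
rewrite -(ler_pM2r un) -(gtr0_norm l0) -normrZ.
apply: (le_trans _ (K_bounded u)); apply: Cb_norm_le => // x.
rewrite CbE ger0_norm; last by rewrite mulr_ge0 // ltW.
exact: le_trans (lu x) (Cb_le_norm _ _).
Qed.

(** The eigenvalue is the Collatz-Wielandt number of K. The extremal vector is
a cluster point v of the images K u of almost optimal unit vectors u, rather
than of the u themselves: l u <= K u implies l (K u) <= K (K u), and
|K u| >= l keeps v away from 0. *)
Theorem krein_rutman_eigenvector :
  exists (r : R) (phi : Cb R T),
    [/\ 0 < r, K phi = r *: phi & forall x, 0 < phi x].
Proof.
pose S := [set l : R | exists u,
  [/\ u != 0, nonneg u & forall x, l * u x <= K u x]].
have S_ub : ubound S M.
  by move=> l [u [uN0 u0 lu]]; exact: collatz_wielandt_le lu.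
pose one := Cb_cst T (1 : R).
have one_ge0 : nonneg one by move=> x; exact: ler01.
have oneN0 : one != 0.
  apply/eqP => /(congr1 (fun u : Cb R T => u t0)) /eqP.
  by rewrite CbE /= oner_eq0.
have K1_gt0 x : 0 < K one x.
  by apply: (K_spread one_ge0 (ltr01 : 0 < one x)); rewrite mdistxx.
have [e0 e0_gt0 e0K] := Cb_gt0_bounded_away T_compact K1_gt0.
have Se0 : S e0 by exists one; split => // x; rewrite mulr1.
pose r := sup S.
have hasS : has_sup S by split; [exists e0|exists M].
have r_gt0 : 0 < r by exact: lt_le_trans e0_gt0 (ub_le_sup hasS.2 Se0).
have M_gt0 : 0 < M by exact: lt_le_trans e0_gt0 (S_ub _ Se0).
have approx n : exists u, [/\ `|u| = 1, nonneg u &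
    forall x, (r - n.+1%:R^-1) * u x <= K u x].
  have [|l [u [uN0 u0 lu]] rl] := sup_adherent (eps := n.+1%:R^-1) _ hasS.
    by rewrite invr_gt0.
  have un : 0 < `|u| by rewrite normr_gt0.
  exists (`|u|^-1 *: u); split => [|x|x].
  - by rewrite normrZ normfV normr_id mulVf // gt_eqF.
  - by rewrite CbE mulr_ge0 // invr_ge0.
  - rewrite linearZ !CbE mulrCA ler_wpM2l ?invr_ge0 //.
    by apply: le_trans (lu x); rewrite ler_wpM2r // ltW.
have [u_ u_P] := choice approx.
have [|v v_cluster] := @compact_cluster u_.
  by move=> n; have [-> _ _] := u_P n.
have near_v (e : R) : 0 < e -> exists u, [/\ `|u| = 1, nonneg u,
    forall x, (r - e) * u x <= K u x & `|K u - v| < e].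
  move=> e_gt0.
  have [N _ Ne] : \forall n \near \oo, n.+1%:R^-1 < e :> R
    by exact: near_infty_natSinv_lt (PosNum e_gt0).
  have [n Nn une] := v_cluster e e_gt0 N.
  exists (u_ n); have [un u0 lu] := u_P n; split => // x.
  apply: le_trans (lu x); rewrite ler_wpM2r // lerD2l lerN2.
  exact/ltW/(Ne n Nn).
have v_ge0 : nonneg v.
  move=> x; apply/ler_addgt0Pl => e /near_v[u [_ u0 _ uv]].
  have := K_ge0 u0 x; have := Cb_normr_le (K u - v) x.
  by rewrite !CbE => /(le_lt_trans) /(_ uv); rewrite ltr_norml; lra.
(* The error made by replacing K u with v is at most e (r + 2 M). *)
have Kv x : r * v x <= K v x.
  apply/ler_addgt0Pl => e' e'_gt0.
  pose e := e' / (r + 2 * M).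
  have rM : 0 < r + 2 * M by lra.
  have e_gt0 : 0 < e by rewrite divr_gt0.
  have [u [un u0 lu uv]] := near_v e e_gt0.
  have Kuv : forall y, `|K u y - v y| <= e.
    by move=> y; apply: le_trans (ltW uv); exact: Cb_normr_le (K u - v) y.
  have h1 : (r - e) * K u x <= K (K u) x.
    have := K_mono (u := (r - e) *: u) (v := K u) lu x.
    by rewrite linearZ CbE.
  have h2 : K (K u) x <= K v x + M * e.
    have : K (K u) x - K v x <= M * e.
      rewrite [leLHS](_ : _ = K (K u - v) x); last by rewrite linearB.
      apply: le_trans (Cb_le_norm _ _) _; apply: le_trans (K_bounded _) _.
      by rewrite ler_wpM2l // ltW.
    by lra.
  have h3 : K u x <= M.
    apply: le_trans (Cb_le_norm _ _) _; apply: le_trans (K_bounded _) _.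
    by rewrite un mulr1.
  have h4 : r * v x <= r * K u x + r * e.
    rewrite -mulrDr ler_pM2l //.
    by have := Kuv x; rewrite ler_norml; lra.
  have h5 : e * K u x <= e * M by rewrite ler_wpM2l // ltW.
  have -> : e' = e * (r + 2 * M) by rewrite /e divfK // gt_eqF.
  by move: h1 h2 h4 h5; rewrite mulrBl mulrDr [e * r]mulrC; lra.
(* If v = 0 then r - e <= |K u| < e for every e. *)
have vN0 : v != 0.
  apply/eqP => v0; pose e := r / 4.
  have e_gt0 : 0 < e by rewrite divr_gt0.
  have [u [un u0 lu]] := near_v e e_gt0; rewrite v0 subr0 => Ku.
  suff : r - e <= `|K u| by rewrite /e in Ku *; lra.
  have re : 0 <= r - e by rewrite /e; lra.
  rewrite -[leLHS]mulr1 -un -(ger0_norm re) -normrZ.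
  apply: Cb_norm_le => // x; rewrite CbE ger0_norm; last by rewrite mulr_ge0.
  exact: le_trans (lu x) (Cb_le_norm _ _).
have Kv_eq : K v = r *: v.
  apply/eqP; rewrite -subr_eq0; apply: contraT => wN0.
  have w0 : nonneg (K v - r *: v) by move=> x; rewrite !CbE subr_ge0.
  have [N Nw] := iter_gt0 w0 wN0.
  have [d d_gt0 dN] := Cb_gt0_bounded_away T_compact Nw.
  pose z := iter N K v.
  have z0 : nonneg z by exact: iter_ge0.
  have Nz : iter N K (K v - r *: v) = K z - r *: z.
    rewrite /z; elim: (N) => //= n ->.
    by rewrite linearB linearZ.
  have zN0 : z != 0.
    apply/eqP => zz; have := Nw t0.
    by rewrite Nz zz linear0 scaler0 subrr CbE ltxx.
  have zn : 0 < `|z| by rewrite normr_gt0.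
  (* K z - r z >= d and z <= |z|, so z tolerates a slightly larger factor. *)
  have : S (r + d / `|z|).
    exists z; split => // x; rewrite mulrDl -lerBrDl.
    have := dN x; rewrite Nz !CbE; apply: le_trans.
    by rewrite mulrAC ler_pdivrMr // ler_wpM2l ?Cb_le_norm // ltW.
  move=> /(ub_le_sup hasS.2); rewrite -/r gerDl.
  by rewrite leNgt divr_gt0.
exists r, v; split => // x; rewrite lt_neqAle v_ge0 andbT eq_sym.
apply: contra_neqN vN0 => /eqP vx.
by apply: (eigen_zero (r := r) v_ge0 _ vx) => y _; rewrite Kv_eq CbE.
Qed.

(** * Simplicity of the eigenvalue *)

Context (r : R) (phi : Cb R T).
Context (r_gt0 : 0 < r) (phi_gt0 : forall x, 0 < phi x).
Context (K_phi : K phi = r *: phi).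

(** The least t with u <= t phi is the maximum of u / phi; what matters is that
equality then holds somewhere. *)
Lemma least_domination u :
  exists t x0, (forall x, u x <= t * phi x) /\ u x0 = t * phi x0.
Proof.
have phiN0 x : phi x != 0 by rewrite gt_eqF.
have [||x0 _ x0_max] :=
    @compact_EVT_max T R (fun x => u x / phi x) setT _ T_compact.
- by exists t0.
- apply: continuous_subspaceT => x; apply: cvgM; first exact: Cb_continuous.
  by apply: cvgV => //; exact: Cb_continuous.
exists (u x0 / phi x0), x0; split => [x|]; last by rewrite divfK.
by rewrite -ler_pdivrMr // x0_max // inE.
Qed.

(** At a contact point x0 of u with t phi, K (t phi - u) x0 = - c phi x0 must
be nonnegative. *)
Lemma jordan_coef_le0 (c : R) u : K u = r *: u + c *: phi -> c <= 0.
Proof.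
move=> Ku; have [t [x0 [tu ux0]]] := least_domination u.
have w0 : nonneg (t *: phi - u) by move=> x; rewrite !CbE subr_ge0.
have := K_ge0 w0 x0.
rewrite linearB linearZZ Ku K_phi !CbE ux0 => h.
by rewrite -(pmulr_lle0 _ (phi_gt0 x0)) mulrC; lra.
Qed.

Lemma jordan_coef_eq0 (c : R) u : K u = r *: u + c *: phi -> c = 0.
Proof.
move=> Ku; apply/eqP; rewrite eq_le (jordan_coef_le0 Ku) /=.
rewrite -oppr_le0; apply: (@jordan_coef_le0 _ (- u)).
by rewrite linearN Ku opprD scalerN scaleNr.
Qed.

Lemma eigenspace_phi u : K u = r *: u -> exists c, u = c *: phi.
Proof.
move=> Ku; have [t [x0 [tu ux0]]] := least_domination u.
exists t; apply/esym/eqP; rewrite -subr_eq0; apply/eqP.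
have w0 : nonneg (t *: phi - u) by move=> x; rewrite !CbE subr_ge0.
apply: (@eigen_zero r _ x0 w0) => [y _|]; last by rewrite !CbE ux0 subrr.
by rewrite linearB linearZZ Ku K_phi !CbE; lra.
Qed.

Lemma krein_rutman_simple : simple_eigenvalue K r.
Proof.
exists phi.
  by apply/eqP => phi0; have := phi_gt0 t0; rewrite phi0 CbE ltxx.
move=> n u; split=> [|[c ->]]; last first.
  rewrite iterSr [X in iter n _ X](_ : _ = 0).
    by elim: n => //= n ->; rewrite linear0 scaler0 subrr.
  by rewrite linearZZ K_phi !scalerA mulrC subrr.
elim: n u => [|n IH] u.
  by move=> /= /eqP; rewrite subr_eq0 => /eqP; exact: eigenspace_phi.
rewrite iterSr => /IH[c /eqP]; rewrite subr_eq addrC => /eqP Ku.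
apply: eigenspace_phi; rewrite Ku.
by rewrite (jordan_coef_eq0 Ku) scale0r addr0.
Qed.

(** * The resolvent outside the disk of radius r *)

Local Notation XX := (Cb R T * Cb R T)%type.
Implicit Types w : XX.

(** Multiplication by the complex number p + i q on the complexification. *)
Definition cscale (p q : R) (w : XX) : XX :=
  (p *: w.1 - q *: w.2, q *: w.1 + p *: w.2).

(** This says that the modulus of w.1 + i w.2 is at most t phi. Writing the
modulus as the supremum of the c w.1 + s w.2 makes its compatibility with the
positive real operator K immediate. *)
Definition dominated (t : R) (w : XX) := forall c s : R,
  c ^+ 2 + s ^+ 2 = 1 -> forall x, c * w.1 x + s * w.2 x <= t * phi x.

Lemma dominated0 t : 0 <= t -> dominated t (0, 0).
Proof.
move=> t_ge0 c s _ x; rewrite [leLHS](_ : _ = c * 0 + s * 0) //.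
by rewrite !mulr0 addr0 mulr_ge0 // ltW.
Qed.

Lemma dominatedD t t' w w' :
  dominated t w -> dominated t' w' -> dominated (t + t') (w + w').
Proof.
move=> tw tw' c s cs x; rewrite mulrDl.
apply: le_trans (lerD (tw c s cs x) (tw' c s cs x)).
rewrite [leLHS](_ : _ = c * (w.1 x + w'.1 x) + s * (w.2 x + w'.2 x)) //.
by lra.
Qed.

(** The rotation by p + i q is moved onto the test pair (c, s). *)
Lemma dominated_cscale (k p q t : R) w : 0 < k -> p ^+ 2 + q ^+ 2 = k ^+ 2 ->
  dominated t w -> dominated (k * t) (cscale p q w).
Proof.
move=> k0 pq tw c s cs x.
pose c' := (c * p + s * q) / k; pose s' := (s * p - c * q) / k.
have cs' : c' ^+ 2 + s' ^+ 2 = 1.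
  rewrite /c' /s' !expr_div_n -mulrDl.
  rewrite (_ : (c * p + s * q) ^+ 2 + (s * p - c * q) ^+ 2 =
    (c ^+ 2 + s ^+ 2) * (p ^+ 2 + q ^+ 2)); last by ring.
  by rewrite cs pq mul1r divff // expf_neq0 // gt_eqF.
have := tw c' s' cs' x; rewrite -(ler_pM2l k0) [X in _ <= X]mulrA.
apply: le_trans; rewrite le_eqVlt; apply/orP; left; apply/eqP.
rewrite [LHS](_ : _ = c * (p * w.1 x - q * w.2 x) +
  s * (q * w.1 x + p * w.2 x)) // /c' /s'.
by field; exact: lt0r_neq0.
Qed.

Lemma dominated_K t w : dominated t w -> dominated (r * t) (K w.1, K w.2).
Proof.
move=> tw c s cs x.
have := @K_mono (c *: w.1 + s *: w.2) (t *: phi) (tw c s cs) x.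
by rewrite linearD !linearZZ K_phi !CbE; lra.
Qed.

Lemma dominated_norm1 t w : 0 <= t -> dominated t w -> `|w.1| <= t * `|phi|.
Proof.
move=> t_ge0 tw; apply: Cb_norm_le => [|x]; first by rewrite mulr_ge0.
have le_phi : t * phi x <= t * `|phi| by rewrite ler_wpM2l // Cb_le_norm.
have h1 : 1 ^+ 2 + 0 ^+ 2 = 1 :> R by ring.
have h2 : (- 1) ^+ 2 + 0 ^+ 2 = 1 :> R by ring.
have := tw _ _ h1 x; have := tw _ _ h2 x.
by rewrite ler_norml; lra.
Qed.

Lemma dominated_norm2 t w : 0 <= t -> dominated t w -> `|w.2| <= t * `|phi|.
Proof.
move=> t_ge0 tw; apply: Cb_norm_le => [|x]; first by rewrite mulr_ge0.
have le_phi : t * phi x <= t * `|phi| by rewrite ler_wpM2l // Cb_le_norm.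
have h1 : 0 ^+ 2 + 1 ^+ 2 = 1 :> R by ring.
have h2 : 0 ^+ 2 + (- 1) ^+ 2 = 1 :> R by ring.
have := tw _ _ h1 x; have := tw _ _ h2 x.
by rewrite ler_norml; lra.
Qed.

Lemma norm_dominated : exists2 C : R, 0 < C &
  forall w : XX, dominated (C * (`|w.1| + `|w.2|)) w.
Proof.
have [e e0 e_phi] := Cb_gt0_bounded_away T_compact phi_gt0.
exists e^-1; first by rewrite invr_gt0.
move=> w c s cs x.
have c1 : `|c| <= 1.
  by rewrite -(@expr_le1 _ 2) // real_normK ?num_real //; have := sqr_ge0 s; lra.
have s1 : `|s| <= 1.
  by rewrite -(@expr_le1 _ 2) // real_normK ?num_real //; have := sqr_ge0 c; lra.
have mul_le (a : R) u : `|a| <= 1 -> a * u x <= `|u|.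
  move=> a1; apply: le_trans (ler_norm _) _; rewrite normrM.
  apply: le_trans (Cb_normr_le u x); rewrite -[leRHS]mul1r.
  by rewrite ler_wpM2r.
apply: (@le_trans _ _ (`|w.1| + `|w.2|)); first by rewrite lerD ?mul_le.
rewrite mulrAC ler_peMl ?addr_ge0 //.
by rewrite mulrC ler_pdivlMr // mul1r.
Qed.

Lemma geometric_le0 (a C q : R) : 0 <= q < 1 ->
  (forall n, a <= C * q ^+ n) -> a <= 0.
Proof.
move=> /andP[q0 q1] aC.
have : (fun n => C * q ^+ n) @ \oo --> C * 0.
  by apply: cvgMr; apply: cvg_expr; rewrite ger0_norm.
rewrite mulr0 => cvg0; apply: (cvgr_to_ge cvg0).
by exists 0%N => // n _; exact: aC.
Qed.

(** Compactness of K replaces completeness: the sequence K (a_ n) has a cluster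
point, which has to be its limit since the sequence is Cauchy. *)
Lemma compact_geometric_limit (a_ : nat -> Cb R T) (L q : R) :
  0 < L -> 0 <= q < 1 -> (forall n, `|a_ n| <= L) ->
  (forall n k, `|a_ (k + n)%N - a_ n| <= L * q ^+ n) ->
  exists b, forall n, `|K (a_ n) - b| <= `|M| * L * q ^+ n.
Proof.
move=> L0 /andP[q0 q1] aL aq.
have [|v v_cluster] := @compact_cluster (fun n => L^-1 *: a_ n).
  by move=> n; rewrite normrZ gtr0_norm ?invr_gt0 // mulrC ler_pdivrMr // mul1r.
exists (L *: v) => n; apply/ler_addgt0Pl => e e0.
have [m nm Kv] := v_cluster (e / L) (divr_gt0 e0 L0) n.
rewrite (_ : K (a_ n) - L *: v =
    L *: (K (L^-1 *: a_ m) - v) - K (a_ m - a_ n)); last first.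
  apply: Cb_ext => x; rewrite [K (a_ m - a_ n)]linearB [K (L^-1 *: _)]linearZZ.
  by rewrite !CbE; field; exact: lt0r_neq0.
apply: le_trans (ler_normB _ _) _; apply: lerD.
  by rewrite normrZ gtr0_norm // -ler_pdivlMl // mulrC ltW.
apply: le_trans (K_bounded _) _; 
apply: le_trans (ler_wpM2r (normr_ge0 _) (ler_norm M)) _.
by rewrite -mulrA ler_wpM2l // -[in leLHS](subnK nm).
Qed.

(** Here p + i q stands for the inverse of a complex number z of modulus m, and
the equation z w - K w = w0 is read as the fixed point equation
w = (p + i q) (w0 + K w). *)
Section resolvent.
Context (p q m : R) (m_gt_r : r < m) (pq_m : p ^+ 2 + q ^+ 2 = m^-1 ^+ 2).

Let m_gt0 : 0 < m. Proof. exact: lt_trans m_gt_r. Qed.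
Let mr_gt0 : 0 < m - r. Proof. by rewrite subr_gt0. Qed.
Let mN0 : m != 0. Proof. by rewrite gt_eqF. Qed.
Let mrN0 : m - r != 0. Proof. by rewrite gt_eqF. Qed.

Definition resolvent_step w0 w : XX := cscale p q (w0 + (K w.1, K w.2)).

Lemma dominated_step (t t' : R) w0 w : dominated t w0 -> dominated t' w ->
  dominated (m^-1 * (t + r * t')) (resolvent_step w0 w).
Proof.
move=> tw0 t'w; apply: dominated_cscale => //; first by rewrite invr_gt0.
by apply: dominatedD => //; exact: dominated_K.
Qed.

Lemma resolvent_stepB w0 w0' w w' :
  resolvent_step w0 w - resolvent_step w0' w' =
  resolvent_step (w0 - w0') (w - w').
Proof.
congr pair; apply: Cb_ext => x;
  rewrite [K (_ - _).1]linearB [K (_ - _).2]linearB.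
- rewrite [RHS](_ : _ = p * (w0.1 x - w0'.1 x + (K w.1 x - K w'.1 x)) -
    q * (w0.2 x - w0'.2 x + (K w.2 x - K w'.2 x))) //.
  rewrite [LHS](_ : _ = p * (w0.1 x + K w.1 x) - q * (w0.2 x + K w.2 x) -
    (p * (w0'.1 x + K w'.1 x) - q * (w0'.2 x + K w'.2 x))) //.
  by ring.
- rewrite [RHS](_ : _ = q * (w0.1 x - w0'.1 x + (K w.1 x - K w'.1 x)) +
    p * (w0.2 x - w0'.2 x + (K w.2 x - K w'.2 x))) //.
  rewrite [LHS](_ : _ = q * (w0.1 x + K w.1 x) + p * (w0.2 x + K w.2 x) -
    (q * (w0'.1 x + K w'.1 x) + p * (w0'.2 x + K w'.2 x))) //.
  by ring.
Qed.

Let contraction_ratio : 0 <= r / m < 1.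
Proof. by rewrite divr_ge0 ?ltW //= ltr_pdivrMr // mul1r. Qed.

(** D = t / (m - r) is the fixed point of the map t' |-> (t + r t') / m through
which a bound on w improves itself. Iterating from any bound whatsoever leads
to D at the geometric rate r / m. *)
Lemma resolvent_apriori (t : R) w0 w :
  dominated t w0 -> w = resolvent_step w0 w -> dominated (t / (m - r)) w.
Proof.
move=> tw0 wE; have [C C0 domC] := norm_dominated.
pose D0 := C * (`|w.1| + `|w.2|); pose D := t / (m - r).
have D_n n : dominated (D + (D0 - D) * (r / m) ^+ n) w.
  elim: n => [|n IH]; first by rewrite expr0 mulr1 subrKC; exact: domC.
  have := dominated_step tw0 IH; rewrite -wE exprS.
  congr (dominated _ _); rewrite /D; field; first exact/andP.
move=> c s cs x; rewrite -subr_le0.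
apply: (geometric_le0 (C := (D0 - D) * phi x) contraction_ratio) => n.
by have := D_n n c s cs x; rewrite -/D; lra.
Qed.

(** Picard iteration from 0. Every iterate obeys the bound D of the limit, so
the difference of two iterates that start n steps apart is at most
D (r / m)^n. *)
Lemma resolvent_fixpoint w0 : exists w, w = resolvent_step w0 w.
Proof.
have [C C0 domC] := norm_dominated.
pose t := C * (`|w0.1| + `|w0.2|).
have tw0 : dominated t w0 by exact: domC.
have t_ge0 : 0 <= t by rewrite mulr_ge0 // ?addr_ge0 // ltW.
pose D := t / (m - r).
have D0 : 0 <= D by rewrite divr_ge0 // ltW.
pose w_ n := iter n (resolvent_step w0) (0, 0).
have w_D n : dominated D (w_ n).
  elim: n => [|n IH]; first exact: dominated0.
  have := dominated_step tw0 IH.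
  congr (dominated _ _); rewrite /D; field; exact/andP.
have w_cauchy n k : dominated (D * (r / m) ^+ n) (w_ (k + n)%N - w_ n).
  elim: n => [|n IH].
    by rewrite addn0 expr0 mulr1 [w_ 0]/= subr0; exact: w_D.
  rewrite addnS [_ - _]resolvent_stepB subrr.
  have := dominated_step (dominated0 (lexx 0)) IH.
  congr (dominated _ _); rewrite exprS; field. exact: mN0.
pose L := D * `|phi| + 1.
have L0 : 0 < L by rewrite ltr_wpDl // mulr_ge0.
have q_ge0 n : 0 <= (r / m) ^+ n by rewrite exprn_ge0 // divr_ge0 // ltW.
have LE n : D * (r / m) ^+ n * `|phi| <= L * (r / m) ^+ n.
  by rewrite mulrAC ler_wpM2r // /L lerDl.
have [||b1 Kb1] := @compact_geometric_limit (fun n => (w_ n).1) L (r / m)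
  L0 contraction_ratio.
- move=> n; apply: le_trans (dominated_norm1 D0 (w_D n)) _.
  by rewrite /L lerDl.
- move=> n k; apply: le_trans (LE n).
  by apply: (dominated_norm1 _ (w_cauchy n k)); rewrite mulr_ge0.
have [||b2 Kb2] := @compact_geometric_limit (fun n => (w_ n).2) L (r / m)
  L0 contraction_ratio.
- move=> n; apply: le_trans (dominated_norm2 D0 (w_D n)) _.
  by rewrite /L lerDl.
- move=> n k; apply: le_trans (LE n).
  by apply: (dominated_norm2 _ (w_cauchy n k)); rewrite mulr_ge0.
pose w := cscale p q (w0 + (b1, b2)); exists w.
pose G := `|M| * L.
have G0 : 0 <= G by rewrite mulr_ge0 // ltW.
have w1 n : `|(w_ n.+1).1 - w.1| <= (`|p| + `|q|) * (G * (r / m) ^+ n).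
  rewrite (_ : _ - _ = p *: (K (w_ n).1 - b1) - q *: (K (w_ n).2 - b2)).
    apply: le_trans (ler_normB _ _) _; rewrite !normrZ mulrDl.
    by apply: lerD; rewrite ler_wpM2l // ?Kb1 ?Kb2.
  apply: Cb_ext => x.
  rewrite [LHS](_ : _ = p * (w0.1 x + K (w_ n).1 x) -
    q * (w0.2 x + K (w_ n).2 x) - (p * (w0.1 x + b1 x) - q * (w0.2 x + b2 x)))
    //.
  by rewrite !CbE; ring.
have w2 n : `|(w_ n.+1).2 - w.2| <= (`|p| + `|q|) * (G * (r / m) ^+ n).
  rewrite (_ : _ - _ = q *: (K (w_ n).1 - b1) + p *: (K (w_ n).2 - b2)).
    apply: le_trans (ler_normD _ _) _; rewrite !normrZ addrC mulrDl.
    by apply: lerD; rewrite ler_wpM2l // ?Kb1 ?Kb2.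
  apply: Cb_ext => x.
  rewrite [LHS](_ : _ = q * (w0.1 x + K (w_ n).1 x) +
    p * (w0.2 x + K (w_ n).2 x) - (q * (w0.1 x + b1 x) + p * (w0.2 x + b2 x)))
    //.
  by rewrite !CbE; ring.
have K_lim (a_ : nat -> Cb R T) a b :
    (forall n, `|K (a_ n) - b| <= G * (r / m) ^+ n) ->
    (forall n, `|a_ n.+1 - a| <= (`|p| + `|q|) * (G * (r / m) ^+ n)) ->
    K a = b.
  move=> Kab ab; apply/eqP; rewrite -subr_eq0 -normr_le0; apply/eqP.
  apply/eqP; apply: (geometric_le0
    (C := G * (r / m) + `|M| * (`|p| + `|q|) * G) contraction_ratio) => n.
  rewrite (_ : K a - b = K (a_ n.+1) - b - K (a_ n.+1 - a)); last first.
    by apply: Cb_ext => x; rewrite [K (_ - a)]linearB !CbE; ring.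
  apply: le_trans (ler_normB _ _) _; rewrite mulrDl; apply: lerD.
    by rewrite -mulrA -exprS; exact: Kab.
  apply: le_trans (K_bounded _) _; 
  apply: le_trans (ler_wpM2r (normr_ge0 _) (ler_norm M)) _.
  apply: le_trans (ler_wpM2l (normr_ge0 M) (ab n)) _.
  by rewrite !mulrA.
by rewrite {1}/w /resolvent_step (K_lim _ _ _ Kb1 w1) (K_lim _ _ _ Kb2 w2).
Qed.

End resolvent.

(** The two quotients are the coordinates of the inverse of a + i b. *)
Lemma complex_shiftP (a b : R) w0 w : a ^+ 2 + b ^+ 2 != 0 ->
  complex_shift K (a +i* b)%C w = w0 <->
  w = resolvent_step (a / (a ^+ 2 + b ^+ 2)) (- b / (a ^+ 2 + b ^+ 2)) w0 w.
Proof.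
move=> n0; split=> [<-|wE].
  rewrite /resolvent_step; case: w => w1 w2.
  congr pair; apply: Cb_ext => x.
  - rewrite [RHS](_ : _ =
      a / (a ^+ 2 + b ^+ 2) * (a * w1 x - b * w2 x - K w1 x + K w1 x) -
      - b / (a ^+ 2 + b ^+ 2) * (b * w1 x + a * w2 x - K w2 x + K w2 x)) //.
    by field.
  - rewrite [RHS](_ : _ =
      - b / (a ^+ 2 + b ^+ 2) * (a * w1 x - b * w2 x - K w1 x + K w1 x) +
      a / (a ^+ 2 + b ^+ 2) * (b * w1 x + a * w2 x - K w2 x + K w2 x)) //.
    by field.
have e1 x : w.1 x = a / (a ^+ 2 + b ^+ 2) * (w0.1 x + K w.1 x) -
    - b / (a ^+ 2 + b ^+ 2) * (w0.2 x + K w.2 x).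
  exact: (congr1 (fun v : XX => v.1 x) wE).
have e2 x : w.2 x = - b / (a ^+ 2 + b ^+ 2) * (w0.1 x + K w.1 x) +
    a / (a ^+ 2 + b ^+ 2) * (w0.2 x + K w.2 x).
  exact: (congr1 (fun v : XX => v.2 x) wE).
rewrite [w0]surjective_pairing; congr pair; apply: Cb_ext => x.
- rewrite [LHS](_ : _ = a * w.1 x - b * w.2 x - K w.1 x) //.
  by rewrite e1 e2; field.
- rewrite [LHS](_ : _ = b * w.1 x + a * w.2 x - K w.2 x) //.
  by rewrite e1 e2; field.
Qed.

Lemma complex_shiftB z w w' :
  complex_shift K z (w - w') = complex_shift K z w - complex_shift K z w'.
Proof.
have K1 x : K (w - w').1 x = K w.1 x - K w'.1 x.
  by rewrite [K _]linearB.
have K2 x : K (w - w').2 x = K w.2 x - K w'.2 x.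
  by rewrite [K _]linearB.
congr pair; apply: Cb_ext => x.
- rewrite [LHS](_ : _ = complex.Re z * (w.1 x - w'.1 x) -
    complex.Im z * (w.2 x - w'.2 x) - K (w - w').1 x) // K1.
  rewrite [RHS](_ : _ = complex.Re z * w.1 x - complex.Im z * w.2 x -
    K w.1 x - (complex.Re z * w'.1 x - complex.Im z * w'.2 x - K w'.1 x)) //.
  by ring.
- rewrite [LHS](_ : _ = complex.Im z * (w.1 x - w'.1 x) +
    complex.Re z * (w.2 x - w'.2 x) - K (w - w').2 x) // K2.
  rewrite [RHS](_ : _ = complex.Im z * w.1 x + complex.Re z * w.2 x -
    K w.2 x - (complex.Im z * w'.1 x + complex.Re z * w'.2 x - K w'.2 x)) //.
  by ring.
Qed.

(** The solution operator is continuous because it is additive and bounded, by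
the a priori estimate. *)
Lemma resolvent_outside_disk z :
  r < ComplexField.Normc.normc z -> resolvent_set K z.
Proof.
case: z => a b /=; set m := Num.sqrt _ => m_gt_r.
have m0 : 0 < m by exact: lt_trans m_gt_r.
have m2 : m ^+ 2 = a ^+ 2 + b ^+ 2 by rewrite sqr_sqrtr // addr_ge0 ?sqr_ge0.
have n0 : a ^+ 2 + b ^+ 2 != 0 by rewrite -m2 expf_neq0 // gt_eqF.
have mr0 : 0 < m - r by rewrite subr_gt0.
pose p := a / (a ^+ 2 + b ^+ 2); pose q := - b / (a ^+ 2 + b ^+ 2).
have pq : p ^+ 2 + q ^+ 2 = m^-1 ^+ 2.
  by rewrite /p /q exprVn m2; field.
have [C C0 domC] := norm_dominated.
have solve w0 : exists w, complex_shift K (a +i* b)%C w = w0.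
  have [w wE] := resolvent_fixpoint m_gt_r pq w0.
  by exists w; apply/complex_shiftP.
have [B BE] := choice solve.
have bound w : `|w| <= C * 2 / (m - r) * `|phi| *
    `|complex_shift K (a +i* b)%C w|.
  set w0 := complex_shift _ _ _.
  have wE : w = resolvent_step p q w0 w by apply/complex_shiftP.
  pose t := C * (`|w0.1| + `|w0.2|) / (m - r).
  have tw : dominated t w by exact: resolvent_apriori (domC w0) wE.
  have t_ge0 : 0 <= t.
    by rewrite divr_ge0 ?(ltW mr0) // mulr_ge0 ?(ltW C0) // addr_ge0.
  have t_le : t <= C * 2 / (m - r) * `|w0|.
    rewrite mulrAC ler_wpM2r ?invr_ge0 ?(ltW mr0) // -mulrA.
    rewrite ler_wpM2l ?(ltW C0) // prod_normE.
    by rewrite mulr_natl mulr2n lerD // le_max lexx ?orbT.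
  rewrite -mulrA [_ * `|w0|]mulrC mulrA prod_normE ge_max.
  have le_t : t * `|phi| <= C * 2 / (m - r) * `|w0| * `|phi|.
    by rewrite ler_wpM2r.
  by rewrite !(le_trans _ le_t) ?dominated_norm1 ?dominated_norm2.
exists B; split => // [|w].
- pose G := C * 2 / (m - r) * `|phi| + 1.
  have G0 : 0 < G.
    rewrite ltr_wpDl // mulr_ge0 // divr_ge0 ?(ltW mr0) // mulr_ge0 //.
    exact: ltW.
  have lip w w' : `|B w - B w'| <= G * `|w - w'|.
    have := bound (B w - B w'); rewrite complex_shiftB !BE => /le_trans; apply.
    by rewrite ler_wpM2r // lerDl.
  move=> w; apply/cvgrPdist_lt => e e0.
  have : \forall w' \near w, `|w - w'| < e / G.
    have eG : 0 < e / G by rewrite divr_gt0.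
    by have := nbhsx_ballx w _ eG; rewrite -ball_normE.
  apply: filterS => w' ww'; apply: le_lt_trans (lip _ _) _.
  by rewrite mulrC -ltr_pdivlMr.
- apply/eqP; rewrite -subr_eq0 -normr_le0.
  apply: le_trans (bound _) _.
  by rewrite complex_shiftB BE subrr normr0 mulr0.
Qed.

Lemma krein_rutman_spectral_radius : spectral_radius K = r.
Proof.
have r_in : [set ComplexField.Normc.normc z | z in spectrum K] r.
  exists (r +i* 0)%C; last by rewrite /= expr0n addr0 sqrtr_sqr gtr0_norm.
  move=> [B [_ shiftK _]].
  have shift_phi : complex_shift K (r +i* 0)%C (phi, 0) =
      complex_shift K (r +i* 0)%C (0, 0).
    rewrite /complex_shift /= K_phi linear0 !scale0r !scaler0 !subr0.
    by rewrite subrr [K 0]linear0 !subr0.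
  have := congr1 B shift_phi; rewrite !shiftK => -[phi0].
  by have := phi_gt0 t0; rewrite phi0 CbE ltxx.
have ub_r : ubound [set ComplexField.Normc.normc z | z in spectrum K] r.
  move=> _ [z zK <-]; rewrite leNgt; apply/negP => rz.
  exact/zK/resolvent_outside_disk.
apply/eqP; rewrite eq_le; apply/andP; split.
  by apply: ge_sup => //; exists r.
by apply: ub_le_sup => //; exists r.
Qed.

End positive_operator.

(** * Kernel operators on a compact metric measure space *)

Section kernel_operators.
Context (R : realType) (d : measure_display).

Lemma Lnorm_mono (T : measurableType d) (mu : {measure set T -> \bar R})
    (p : \bar R) (f g : T -> R) :
  (1 <= p)%E -> measurable_fun setT f -> measurable_fun setT g ->
  (forall x, `|f x| <= `|g x|) ->
  ('N[mu]_p[EFin \o f] <= 'N[mu]_p[EFin \o g])%E.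
Proof.
case: p => [p||] //= p1 mf mg fg; rewrite unlock.
  have p0 : 0 <= p by apply: le_trans ler01 _; rewrite -lee_fin.
  have mpow (h : T -> R) : measurable_fun setT h ->
      measurable_fun setT (fun x => `|h x| `^ p).
    move=> mh.
    apply: (@measurableT_comp _ _ _ _ _ _ (@powR R ^~ p)) => //.
    exact: measurableT_comp.
  have le_pow x : (`|(f x)%:E| `^ p <= `|(g x)%:E| `^ p)%E.
    by rewrite lee_fin ge0_ler_powR // nnegrE.
  apply: gt0_ler_poweR; rewrite ?invr_ge0 //.
  - by rewrite in_itv /= leey andbT integral_ge0.
  - by rewrite in_itv /= leey andbT integral_ge0.
  - apply: ge0_le_integral => //.
    + by move=> x _; exact: poweR_ge0.
    + exact/measurable_EFinP/mpow.
    + exact/measurable_EFinP/mpow.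
    + by move=> x _; exact: le_pow.
case: (boolP (0 < mu [set: T])%E) => //= _.
by apply: le_ess_sup; apply: nearW => x /=; rewrite lee_fin.
Qed.

Context (T : metricMeasurableType R d) (mu : {measure set T -> \bar R}).
Context (mu_mm : metric_measure mu).

Lemma metric_ball_open (x : T) (e : R) : open (ball x e).
Proof.
rewrite openE => y; rewrite ballEmdist /= => xy.
have e' : 0 < e - mdist x y by rewrite subr_gt0.
apply: (@filterS _ (nbhs y) _ (ball y (e - mdist x y))); last first.
  exact: nbhsx_ballx.
move=> z; rewrite ballEmdist /= => yz.
by apply: le_lt_trans (metric_triangle x y z) _; rewrite -ltrBrDl.
Qed.

Lemma ball_measurable (x : T) (e : R) : measurable (ball x e).
Proof. exact/(mm_borel mu_mm)/metric_ball_open. Qed.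

Lemma Cb_measurable (u : Cb R T) : measurable_fun [set: T] u.
Proof.
apply: (measurability _ (RGenOpens.measurableE R)).
move=> _ [_ [a [b ->] <-]]; rewrite setTI; apply: (mm_borel mu_mm).
apply: open_comp; last exact: interval_open.
by move=> x _; exact: Cb_continuous.
Qed.

Context (T_compact : compact [set: T]).

(** A compact metric space is a ball, and balls have finite measure. *)
Lemma compact_metric_measure_fin : (mu [set: T] < +oo)%E.
Proof.
have cover := (compact_near_coveringP _).1 T_compact.
have /cover : forall x : T, [set: T] x ->
    \forall x' \near x & e \near +oo, mdist point x' < e :> R.
  move=> x _; exists (ball x 1, [set e | mdist point x + 1 < e]).
    split; first exact: nbhsx_ballx.
    by exists (mdist point x + 1); split => //; exact: num_real.
  move=> [x' e] [] /=; rewrite ballEmdist /= => xx' xe.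
  apply: le_lt_trans (metric_triangle point x x') _.
  by apply: lt_trans xe; rewrite ltrD2l.
move=> [e0 [_ e0P]].
pose e := Num.max 0 e0 + 1.
have e_gt : e0 < e by rewrite /e ltr_pwDr // le_max lexx orbT.
have e_gt0 : 0 < e by rewrite /e ltr_pwDr // le_max lexx.
have -> : [set: T] = ball point e.
  by apply/seteqP; split => // x _; rewrite ballEmdist; exact: e0P.
exact: (mm_ball mu_mm point e_gt0).2.
Qed.

Lemma compact_metric_measure_gt0 : (0 < mu [set: T])%E.
Proof.
apply: lt_le_trans (mm_ball mu_mm point ltr01).1 _.
by apply: le_measure; rewrite ?inE //; exact: ball_measurable.
Qed.

Context (p : \bar R) (p1 : (1 <= p)%E).

Lemma Cb_Lfun (u : Cb R T) : (u : T -> R) \in Lfun mu p.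
Proof.
have fin1 : finite_norm mu p (fun=> `|u| : R).
  rewrite /finite_norm.
  have -> : EFin \o (fun=> `|u|) = cst `|u|%:E :> (T -> \bar R) by [].
  have := p1; case: (p) => [q||] // q1; rewrite unlock.
    rewrite poweR_lty // integral_cst //.
    by rewrite lte_mul_pinfty // ?compact_metric_measure_fin // lee_fin powR_ge0.
  rewrite compact_metric_measure_gt0 //.
  rewrite (@ess_sup_ae_cst _ _ _ _ _ `|u|%:E) ?ltry //.
    exact: compact_metric_measure_gt0.
  by apply: nearW => x /=; rewrite normr_id.
rewrite inE; apply/andP; split; rewrite inE /=; first exact: Cb_measurable.
apply: le_lt_trans fin1; apply: Lnorm_mono => //.
  exact: Cb_measurable.
by move=> x; rewrite normr_id; exact: Cb_normr_le.
Qed.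

Definition Cb_to_Lp (u : Cb R T) : LfunType mu p1 := Lfun_Sub p1 (Cb_Lfun u).

Lemma Cb_to_Lp_linear : linear Cb_to_Lp.
Proof. by move=> a u v; apply/LfuneqP. Qed.

HB.instance Definition _ := GRing.isLinear.Build R (Cb R T) (LfunType mu p1)
  _ Cb_to_Lp Cb_to_Lp_linear.

(** Comparison with a constant function makes a single argument work for finite
and infinite p. *)
Lemma Lp_norm_Cb (u : Cb R T) :
  Lp_norm (Cb_to_Lp u) <= `|u| * Lp_norm (Cb_to_Lp (Cb_cst T 1)).
Proof.
rewrite -lee_fin EFinM /Lp_norm !finite_norm_fine -[`|u|]normr_id -LnormZ.
apply: Lnorm_mono => //; first exact: measurable_funM.
move=> x; rewrite /= normrM normr_id normr1 mulr1; exact: Cb_normr_le.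
Qed.

Lemma Lp_norm_ge0 (u : LfunType mu p1) : 0 <= Lp_norm u.
Proof. by rewrite /Lp_norm fine_ge0 // Lnorm_ge0. Qed.

Lemma bounded_operator_Cb (A : {linear LfunType mu p1 -> Cb R T}) :
  bounded_operator (@Lp_norm _ _ _ mu p p1) A ->
  bounded_operator Num.norm (A \o Cb_to_Lp).
Proof.
move=> [C AC]; exists (`|C| * Lp_norm (Cb_to_Lp (Cb_cst T 1))) => u /=.
apply: le_trans (AC _) _.
apply: le_trans (ler_wpM2r (Lp_norm_ge0 _) (ler_norm C)) _.
by rewrite -mulrA ler_wpM2l // mulrC; exact: Lp_norm_Cb.
Qed.

(** The unit ball of continuous functions lies in a multiple of the one of
L^p. Adding 1 to the norm of the inclusion makes the factor invertible. *)
Lemma compact_operator_Cb (A : {linear LfunType mu p1 -> Cb R T}) :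
  compact_operator (@Lp_norm _ _ _ mu p p1) A ->
  compact_operator Num.norm (A \o Cb_to_Lp).
Proof.
move=> [U AU [cU _]].
pose c := Lp_norm (Cb_to_Lp (Cb_cst T 1)) + 1.
have c0 : 0 < c by rewrite ltr_wpDl // Lp_norm_ge0.
have cZ : compact [set c *: v | v in U].
  apply: continuous_compact => //; apply: continuous_subspaceT => v.
  exact: scaler_continuous.
apply: (precompact_subset _ (compact_precompact _ cZ)); last first.
  exact: norm_hausdorff.
move=> _ [u u1 <-] /=; exists (A (c^-1 *: Cb_to_Lp u)).
  apply: (AU (A _)); exists (c^-1 *: Cb_to_Lp u) => //=.
  rewrite -linearZZ; apply: le_trans (Lp_norm_Cb _) _.
  rewrite normrZ gtr0_norm ?invr_gt0 // -mulrA ler_pdivrMl // mulr1.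
  apply: le_trans (ler_wpM2r (Lp_norm_ge0 _) u1) _.
  by rewrite mul1r lerDl.
by rewrite linearZZ scalerA divff ?gt_eqF // scale1r.
Qed.

Context (J : T -> T -> R) (J_ge0 : forall x y, 0 <= J x y).
Context (rho : R) (J_pos : forall x y, mdist x y < rho -> 0 < J x y).

Lemma kernel_op_ge0 (u : T -> R) x :
  (forall y, 0 <= u y) -> 0 <= kernel_op mu J u x.
Proof. by move=> u0; apply: Rintegral_ge0 => y _; rewrite mulr_ge0. Qed.

(** If the integral vanished, its nonnegative integrand would vanish almost
everywhere, yet it is positive on a ball around x. *)
Lemma kernel_op_gt0 (u : Cb R T) x y : kernel_op_defined mu J u ->
  (forall z, 0 <= u z) -> 0 < u x -> mdist x y < rho ->
  0 < kernel_op mu J u y.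
Proof.
move=> Ju u0 ux xy; rewrite lt_neqAle kernel_op_ge0 // andbT.
apply/eqP => K0.
have Jy : mu.-integrable [set: T] (fun z => (J y z * u z)%:E) := Ju y.
have int0 : (\int[mu]_z `|(J y z * u z)%:E| = 0)%E.
  transitivity (\int[mu]_z (J y z * u z)%:E)%E.
    by apply: eq_integral => z _; rewrite gee0_abs // lee_fin mulr_ge0.
  rewrite -[LHS]fineK; last exact: integrable_fin_num.
  by congr EFin; exact: esym K0.
have [N [mN N0 subN]] :
    ae_eq mu [set: T] (fun z => (J y z * u z)%:E) (cst 0%E).
  apply/ae_eq_integral_abs => //; exact: measurable_int Jy.
have : nbhs x (ball y rho `&` [set z | 0 < u z]).
  apply: open_nbhs_nbhs; split.
    by apply: openI; [exact: metric_ball_open|exact: open_Cb_gt0].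
  by split => //; rewrite ballEmdist /= metric_sym.
move=> /nbhs_ballP[e /= e0 eP].
have : (mu (ball x e) <= mu N)%E.
  apply: le_measure; rewrite ?inE //; first exact: ball_measurable.
  move=> z /eP[]; rewrite ballEmdist /= => yz uz; apply: subN => /= h.
  have [] := h I => /eqP; rewrite mulf_eq0 !gt_eqF ?J_pos //.
by rewrite N0 leNgt (mm_ball mu_mm x e0).1.
Qed.

End kernel_operators.

Theorem proposition3p20 (R : realType) (d : measure_display)
    (T : metricMeasurableType R d) (mu : {measure set T -> \bar R})
    (mu_mm : metric_measure mu)
    (T_compact : compact [set: T]) (T_connected : connected [set: T])
    (J : T -> T -> R)
    (J_ge0 : forall x y, 0 <= J x y)
    (J_sym : forall x y, J x y = J y x)
    (J_pos : exists2 r : R, 0 < r & forall x y, mdist x y < r -> 0 < J x y)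
    (K_Lp : exists (p : \bar R) (p1 : (1 <= p)%E)
                   (K : {linear LfunType mu p1 -> Cb R T}),
      [/\ is_kernel_op_Lp J K,
          bounded_operator (@Lp_norm R d T mu p p1) K
        & compact_operator (@Lp_norm R d T mu p p1) K]) :
  exists K : {linear Cb R T -> Cb R T},
    [/\ is_kernel_op_Cb mu J K,
        bounded_operator Num.norm K,
        compact_operator Num.norm K
      & [/\ 0 < spectral_radius K,
            simple_eigenvalue K (spectral_radius K)
          & exists2 phi : Cb R T, K phi = spectral_radius K *: phi &
              forall x, 0 < phi x]].
Proof.
have [p [p1 [A [AJ A_bounded A_compact]]]] := K_Lp.
have [rho rho_gt0 rho_pos] := J_pos.
pose K : {linear Cb R T -> Cb R T} := A \o Cb_to_Lp mu_mm T_compact p1.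
have KJ : is_kernel_op_Cb mu J K.
  by move=> u; exact: AJ (Cb_to_Lp mu_mm T_compact p1 u).
have K_bounded : bounded_operator Num.norm K by exact: bounded_operator_Cb.
have K_compact : compact_operator Num.norm K by exact: compact_operator_Cb.
have K_ge0 u : nonneg u -> nonneg (K u).
  by move=> u0 x; rewrite (KJ u).2; exact: kernel_op_ge0.
have K_spread u x y : nonneg u -> 0 < u x -> mdist x y < rho -> 0 < K u y.
  move=> u0 ux xy; rewrite (KJ u).2.
  exact: (kernel_op_gt0 mu_mm J_ge0 rho_pos (KJ u).1 u0 ux xy).
have [M KM] := K_bounded.
have [r [phi [r_gt0 K_phi phi_gt0]]] :=
  krein_rutman_eigenvector T_compact T_connected point K_ge0 rho_gt0 K_spread
    K_compact KM.
exists K; split => //.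
have -> : spectral_radius K = r.
  exact: (krein_rutman_spectral_radius T_compact point K_ge0 K_compact KM
    r_gt0 phi_gt0 K_phi).
split => //; last by exists phi.
exact: (krein_rutman_simple T_compact T_connected point K_ge0 rho_gt0 K_spread
  phi_gt0 K_phi).
Qed.
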